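(* Let $R$ be a gcd-domain, let $(a_n)_{n\geqslant 1}$ be a sequence of nonzero elements of $R$, and let $(c_n)_{n\geqslant 1}$ be the lcm-sequence of $(a_n)$, that is, $c_1=a_1$ and $$c_n=\frac{[a_1,\dots,a_n]}{[a_1,\dots,a_{n-1}]}\quad\text{for } n\geqslant 2.$$ Then the following two conditions are equivalent (all equalities in $R$ being understood up to multiplication by units of $R$): (1) $(a_n)$ is a strong divisibility sequence, i.e. $(a_m,a_n)=a_{\gcd(m,n)}$ for all $m,n\geqslant 1$; (2) $a_n=\prod_{d\mid n} c_d$ for all $n\geqslant 1$, where $d$ runs over the positive divisors of $n$.
   Context: A gcd-domain is a commutative ring with identity without zero divisors (an integral domain) in which any two nonzero elements have a greatest common divisor. In a gcd-domain any finitely many nonzero elements $x_1,\dots,x_k$ have a greatest common divisor, denoted $(x_1,\dots,x_k)$, and a least common multiple, denoted $[x_1,\dots,x_k]$; both are defined by the usual divisibility properties (no linear-combination property is assumed) and are determined only up to units. Convention: elements such as gcd's, lcm's and the $c_n$ are determined only up to units of $R$, and every equality involving them means equality up to a unit (i.e. the two sides are associates). The quotient $[a_1,\dots,a_n]/[a_1,\dots,a_{n-1}]$ is an element of $R$ since $[a_1,\dots,a_{n-1}]$ divides $[a_1,\dots,a_n]$. *)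

(* Defs.v *)
From mathcomp Require Import all_boot all_order all_algebra.

Set Implicit Arguments.
Unset Strict Implicit.
Unset Printing Implicit Defensive.

Import GRing.Theory.
Local Open Scope ring_scope.

Definition divides (R : idomainType) (x y : R) : Prop :=
  exists z : R, y = z * x.

Definition associated (R : idomainType) (x y : R) : Prop :=
  exists2 u : R, u \is a GRing.unit & y = u * x.

(* Gcds and lcms are determined only up to units, so they are given as
   relations; [is_gcd s d] reads "(x_1, ..., x_k) = d up to a unit". *)
Definition is_gcd (R : idomainType) (s : seq R) (d : R) : Prop :=
  {in s, forall x, divides d x} /\
  (forall e : R, {in s, forall x, divides e x} -> divides e d).

Definition is_lcm (R : idomainType) (s : seq R) (l : R) : Prop :=
  {in s, forall x, divides x l} /\
  (forall e : R, {in s, forall x, divides x e} -> divides l e).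

Definition gcd_domain (R : idomainType) : Prop :=
  forall x y : R, x != 0 -> y != 0 -> exists d : R, is_gcd [:: x; y] d.

(* Sequences indexed from 1 are functions on nat whose value at 0 is
   irrelevant. *)
Definition prefix1 (R : idomainType) (a : nat -> R) (n : nat) : seq R :=
  [seq a i | i <- iota 1 n].

(* The quotient l / l' is the element q with q * l' = l; it is unique since
   l' != 0 for nonzero a_i. *)
Definition is_lcm_sequence (R : idomainType) (a c : nat -> R) : Prop :=
  associated (c 1%N) (a 1%N) /\
  (forall n : nat, (2 <= n)%N ->
     exists l l' : R,
       [/\ is_lcm (prefix1 a n) l,
           is_lcm (prefix1 a n.-1) l' &
           associated (c n * l') l]).

Definition strong_divisibility_sequence (R : idomainType) (a : nat -> R) :
    Prop :=
  forall m n : nat, (1 <= m)%N -> (1 <= n)%N ->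
    is_gcd [:: a m; a n] (a (gcdn m n)).

(* Main.v *)
Require Import Defs.
From mathcomp Require Import all_boot all_order all_algebra.

Import GRing.Theory.
Local Open Scope ring_scope.

(** Write [L_N] for the lcm of [a_1, ..., a_N]; the defining relation of [c]
    telescopes to [L_N = c_1 * ... * c_N] ([lcm_prefix1_prod]).  So the lcm of
    [a_n] and [L_(n-1)] is [c_n * L_(n-1)] ([lcm_seq_step]), and both
    implications exploit this one fact.

    From strong divisibility to the product formula.  More generally, for every
    divisor-closed set [S] of indices the lcm of the [a_i], [i] in [S], is the
    product of the [c_i] ([lcm_dvd_closed_prod]); the set of divisors of [n]
    gives the formula.  One adds the elements of [S] in increasing order.  When
    [n] is added to the set [S'] of smaller elements, the old lcm [P] divides
    [L_(n-1)], and it has to be multiplied by [a_n / (a_n, P)].  The gcd of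
    [a_n] with [L_(n-1)] is the lcm of the [(a_n, a_k) = a_(gcd(n, k))],
    [k < n], because gcd distributes over lcm ([divides_lcm_glue]).  As
    [gcd(n, k)] is a proper divisor of [n], it lies in [S'], so that
    [(a_n, P) = (a_n, L_(n-1))], and the new factor is [c_n] as it is for the
    full prefix ([lcm_cofactor_transfer]).

    From the product formula to strong divisibility.  Now [a_n = c_n * A] and
    [L_(n-1) = A * B], where [A] collects the [c_k] for proper divisors [k] of
    [n] and [B] the other [c_k], [k < n].  That their lcm is [c_n * A * B] means
    that [c_n] and [B] are coprime; hence [c_i] and [c_j] are coprime whenever
    neither index divides the other ([coprime_lcm_seq]).  Removing from [a_m]
    and [a_n] the common factor [a_(gcd(m, n))] leaves products of [c_i], with
    [i] dividing [m] and not [n], and of [c_j], with [j] dividing [n] and not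
    [m]; these are coprime. *)

(** * Divisibility and associates *)

Lemma divides_refl {R : idomainType} (x : R) : divides x x.
Proof. by exists 1; rewrite mul1r. Qed.

Lemma divides_trans {R : idomainType} (y x z : R) :
  divides x y -> divides y z -> divides x z.
Proof. by case=> u -> [v ->]; exists (v * u); rewrite mulrA. Qed.

Lemma divides1 {R : idomainType} (x : R) : divides 1 x.
Proof. by exists x; rewrite mulr1. Qed.

Lemma divides_mull {R : idomainType} (x y : R) : divides x (y * x).
Proof. by exists y. Qed.

Lemma divides_mulr {R : idomainType} (x y : R) : divides x (x * y).
Proof. by exists y; rewrite mulrC. Qed.

Lemma divides_mul2l {R : idomainType} (z x y : R) :
  divides x y -> divides (z * x) (z * y).
Proof. by case=> u ->; exists u; rewrite mulrCA. Qed.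

Lemma divides_pmul2l {R : idomainType} (z x y : R) :
  z != 0 -> divides (z * x) (z * y) -> divides x y.
Proof. by move=> z0 [u E]; exists u; apply: (mulfI z0); rewrite E mulrCA. Qed.

Lemma divides_neq0 {R : idomainType} (x y : R) :
  divides x y -> y != 0 -> x != 0.
Proof. by case=> u ->; rewrite mulf_eq0 negb_or => /andP[]. Qed.

Lemma divides_prod_filter {R : idomainType} (r : seq nat) (P : pred nat)
    (F : nat -> R) :
  divides (\prod_(i <- r | P i) F i) (\prod_(i <- r) F i).
Proof. rewrite [X in divides _ X](bigID P) /=; exact: divides_mulr. Qed.

Lemma associatedP {R : idomainType} (x y : R) :
  associated x y <-> divides x y /\ divides y x.
Proof.
split=> [[u uU ->]|[[u yE] [v xE]]].
  by split; [exists u | exists u^-1; rewrite mulKr].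
have [y0|y0] := eqVneq y 0.
  by exists 1; rewrite ?unitr1 // xE y0 mulr0 mulr0.
exists u => //; apply/unitrP; exists v.
suff uv : u * v = 1 by rewrite mulrC uv.
by apply: (mulIf y0); rewrite -mulrA -xE -yE mul1r.
Qed.

(** * Gcds and lcms of two elements *)

Lemma is_gcd2P {R : idomainType} (x y d : R) :
  is_gcd [:: x; y] d <->
  [/\ divides d x, divides d y
    & forall e, divides e x -> divides e y -> divides e d].
Proof.
split=> [[dv un]|[dx dy un]].
  split=> [||e ex ey]; [by apply: dv; rewrite !inE eqxx ?orbT..|].
  by apply: un => z; rewrite !inE => /orP[]/eqP->.
split=> [z|e ez]; first by rewrite !inE => /orP[]/eqP->.
by apply: un; apply: ez; rewrite !inE eqxx ?orbT.
Qed.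

Lemma is_lcm2P {R : idomainType} (x y l : R) :
  is_lcm [:: x; y] l <->
  [/\ divides x l, divides y l
    & forall e, divides x e -> divides y e -> divides l e].
Proof.
split=> [[dv un]|[dx dy un]].
  split=> [||e ex ey]; [by apply: dv; rewrite !inE eqxx ?orbT..|].
  by apply: un => z; rewrite !inE => /orP[]/eqP->.
split=> [z|e ez]; first by rewrite !inE => /orP[]/eqP->.
by apply: un; apply: ez; rewrite !inE eqxx ?orbT.
Qed.

Lemma is_lcm_eq_mem {R : idomainType} (s t : seq R) (l : R) :
  s =i t -> is_lcm s l -> is_lcm t l.
Proof.
move=> st [dv un]; split=> [x|e ez]; first by rewrite -st; apply: dv.
by apply: un => x; rewrite st; apply: ez.
Qed.

Lemma is_lcm_divides {R : idomainType} (s : seq R) (l l' : R) :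
  is_lcm s l -> is_lcm s l' -> divides l l'.
Proof. by move=> [_ un] [dv _]; apply: un. Qed.

Lemma is_lcm_associated {R : idomainType} (s : seq R) (l l' : R) :
  is_lcm s l -> associated l l' -> is_lcm s l'.
Proof.
move=> [dv un] /associatedP[ll' l'l]; split=> [x /dv xl|e /un le].
  exact: divides_trans ll'.
exact: divides_trans le.
Qed.

Lemma is_lcm_cons {R : idomainType} (x : R) (s : seq R) (l0 l : R) :
  is_lcm s l0 -> is_lcm (x :: s) l <-> is_lcm [:: x; l0] l.
Proof.
move=> [dv0 un0]; split=> [[dv un]|/is_lcm2P[xl l0l un]].
  apply/is_lcm2P; split=> [||e xe l0e].
  - by apply: dv; rewrite inE eqxx.
  - by apply: un0 => y ys; apply: dv; rewrite inE ys orbT.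
  - apply: un => y; rewrite inE => /orP[/eqP->//|/dv0 yl0].
    exact: divides_trans l0e.
split=> [y|e ez].
  rewrite inE => /orP[/eqP->//|/dv0 yl0]; exact: divides_trans l0l.
apply: un; first by apply: ez; rewrite inE eqxx.
by apply: un0 => y ys; apply: ez; rewrite inE ys orbT.
Qed.

(** * Arithmetic of gcd-domains *)

(** Weaker than comaximality: in [k[X, Y]] the elements [X] and [Y] are coprime
    although they generate a proper ideal. *)
Definition coprime_elts {R : idomainType} (x y : R) : Prop :=
  is_gcd [:: x; y] 1.

Lemma coprime_eltsP {R : idomainType} (x y : R) :
  coprime_elts x y <->
  (forall e, divides e x -> divides e y -> divides e 1).
Proof.
split=> [/is_gcd2P[]//|H]; apply/is_gcd2P.
by split=> //; apply: divides1.
Qed.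

Lemma coprime_elts_sym {R : idomainType} (x y : R) :
  coprime_elts x y -> coprime_elts y x.
Proof. by move=> /coprime_eltsP H; apply/coprime_eltsP => e ey ex; apply: H. Qed.

Lemma coprime_elts_divides {R : idomainType} (x y x' y' : R) :
  divides x' x -> divides y' y -> coprime_elts x y -> coprime_elts x' y'.
Proof.
move=> xx yy /coprime_eltsP H; apply/coprime_eltsP => e ex ey.
by apply: H; [apply: divides_trans xx | apply: divides_trans yy].
Qed.

Lemma gcd_exists {R : idomainType} (hR : gcd_domain R) (x y : R) :
  exists d, is_gcd [:: x; y] d.
Proof.
have dv0 (z : R) : divides z 0 by exists 0; rewrite mul0r.
have [->|x0] := eqVneq x 0.
  by exists y; apply/is_gcd2P; split=> //; apply: divides_refl.
have [->|y0] := eqVneq y 0.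
  by exists x; apply/is_gcd2P; split=> //; apply: divides_refl.
exact: hR.
Qed.

(** The gcd of [z * x] and [z * y] is a multiple [z * f] of [z], and [f] is then
    a common divisor of [x] and [y]. *)
Lemma is_gcd_mull {R : idomainType} (hR : gcd_domain R) (z x y d : R) :
  is_gcd [:: x; y] d -> is_gcd [:: z * x; z * y] (z * d).
Proof.
move=> /is_gcd2P[dx dy un].
apply/is_gcd2P; split=> [||e ex ey]; [exact: divides_mul2l..|].
have [z0|z0] := eqVneq z 0; first by exists 0; rewrite z0 !mul0r.
have [G /is_gcd2P[Gx Gy unG]] := gcd_exists hR (z * x) (z * y).
have [f GE] : divides z G by apply: unG; apply: divides_mulr.
apply: divides_trans (unG e ex ey) _; move: Gx Gy; rewrite GE mulrC => Gx Gy.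
by apply/divides_mul2l/un; apply: divides_pmul2l z0 _.
Qed.

(** Gauss's lemma: [x] divides [z * x] and [z * y], hence their gcd [z]. *)
Lemma coprime_elts_Gauss {R : idomainType} (hR : gcd_domain R) (x y z : R) :
  coprime_elts x y -> divides x (y * z) -> divides x z.
Proof.
move=> /(is_gcd_mull hR z _ _ _) /is_gcd2P[_ _ un] xyz.
by rewrite -[z]mulr1; apply: un; [apply: divides_mull | rewrite mulrC].
Qed.

Lemma coprime_eltsMr {R : idomainType} (hR : gcd_domain R) (x y z : R) :
  coprime_elts x y -> coprime_elts x z -> coprime_elts x (y * z).
Proof.
move=> xy /coprime_eltsP xz; apply/coprime_eltsP => e ex eyz.
apply: xz => //; apply: (coprime_elts_Gauss hR _ y _ _ eyz).
exact: (coprime_elts_divides _ _ _ _ ex (divides_refl y) xy).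
Qed.

Lemma coprime_elts_prod {R : idomainType} (hR : gcd_domain R) (x : R)
    (r : seq nat) (P : pred nat) (F : nat -> R) :
  {in r, forall i, P i -> coprime_elts x (F i)} ->
  coprime_elts x (\prod_(i <- r | P i) F i).
Proof.
move=> H; rewrite big_seq_cond; apply: (big_ind (coprime_elts x)).
- by apply/coprime_eltsP.
- exact: coprime_eltsMr.
- by move=> i /andP[ir Pi]; apply: H.
Qed.

Lemma gcd_cofactors {R : idomainType} (hR : gcd_domain R) (x y : R) :
  x != 0 ->
  exists g x' y' : R,
    [/\ g != 0, x = g * x', y = g * y' & coprime_elts x' y'].
Proof.
move=> x0; have [g /is_gcd2P[gx gy un]] := gcd_exists hR x y.
have g0 := divides_neq0 _ _ gx x0.
case: gx gy => x' xE [y' yE]; exists g, x', y'.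
split; [by [] | by rewrite mulrC | by rewrite mulrC |].
apply/coprime_eltsP => e ex ey; apply: (divides_pmul2l g) => //.
rewrite mulr1; apply: un; rewrite ?xE ?yE [_ * g]mulrC.
all: exact: divides_mul2l.
Qed.

Lemma is_lcm_cofactors {R : idomainType} (hR : gcd_domain R) (g x y : R) :
  g != 0 -> coprime_elts x y -> is_lcm [:: g * x; g * y] (g * x * y).
Proof.
move=> g0 xy; apply/is_lcm2P; split=> [||e [w ->]].
- exact: divides_mulr.
- by rewrite mulrAC; apply: divides_mulr.
rewrite mulrCA => /(divides_pmul2l _ _ _ g0).
rewrite mulrC => /(coprime_elts_Gauss hR _ _ _ (coprime_elts_sym _ _ xy)) yw.
by rewrite -mulrA; do 2!apply: divides_mul2l.
Qed.

Lemma lcm_exists {R : idomainType} (hR : gcd_domain R) (s : seq R) :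
  {in s, forall x, x != 0} -> exists2 l, l != 0 & is_lcm s l.
Proof.
elim: s => [|x s IH] s0.
  exists 1; first exact: oner_neq0.
  by split=> // e _; apply: divides1.
have [|l l0 sl] := IH; first by move=> y ys; apply: s0; rewrite inE ys orbT.
have x0 : x != 0 by apply: s0; rewrite inE eqxx.
have [g [x' [l' [g0 xE lE co]]]] := gcd_cofactors hR x l x0.
exists (g * x' * l').
  by rewrite -xE mulf_neq0 //; apply: contraNneq l0 => l'0; rewrite lE l'0 mulr0.
by apply/(is_lcm_cons _ _ _ _ sl); rewrite xE lE; apply: is_lcm_cofactors.
Qed.

(** Distributivity of gcd over lcm in the form [e = [(e, x), (e, y)]].  With
    [x = g * x'] and [y = g * y'] as above and [f] the gcd of [e] and [g], the
    cofactor of [f] in [e] divides [x' * y'], so it splits as a product [p * q]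
    with [p] dividing [x'] and [q] dividing [y'], necessarily coprime.  The
    witnesses are [f * p] and [f * q]. *)
Lemma divides_lcm2_split {R : idomainType} (hR : gcd_domain R) (x y l e : R) :
  x != 0 -> is_lcm [:: x; y] l -> divides e l ->
  exists p q : R,
    [/\ divides p x, divides q y & is_lcm [:: p; q] e].
Proof.
move=> x0 xyl el; have [g [x' [y' [g0 xE yE co]]]] := gcd_cofactors hR x y x0.
move: x0 xyl; rewrite xE yE => x0 xyl.
have x'0 : x' != 0 by apply: contraNneq x0 => ->; rewrite mulr0.
have eg : divides e (g * (x' * y')).
  rewrite mulrA; apply: divides_trans el (is_lcm_divides _ _ _ xyl _).
  exact: is_lcm_cofactors.
have [f [g' [e' [f0 gE eE cge]]]] := gcd_cofactors hR g e g0.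
have {eg} e'xy : divides e' (x' * y').
  apply: (coprime_elts_Gauss hR _ g'); first exact: coprime_elts_sym.
  by apply: (divides_pmul2l f) => //; rewrite mulrA -gE -eE.
have [p [x1 [q [p0 x'E e'E cxq]]]] := gcd_cofactors hR x' e' x'0.
have qy : divides q y'.
  apply: (coprime_elts_Gauss hR _ x1); first exact: coprime_elts_sym.
  by apply: (divides_pmul2l p) => //; rewrite mulrA -x'E -e'E.
exists (f * p), (f * q); split.
- by rewrite gE -mulrA; apply/divides_mul2l; rewrite x'E mulrCA; apply: divides_mulr.
- rewrite gE -mulrA; apply/divides_mul2l; exact: divides_trans (divides_mull _ _).
rewrite eE e'E mulrA; apply: is_lcm_cofactors => //.
apply: (coprime_elts_divides _ _ _ _ _ qy co); rewrite x'E; exact: divides_mulr.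
Qed.

(** Distributivity of gcd over lcm for a finite family, phrased as a gluing
    principle: a divisor [e] of the lcm is the lcm of its common divisors with
    the single entries. *)
Lemma divides_lcm_glue {R : idomainType} (hR : gcd_domain R) (s : seq R)
    (l e z : R) :
  {in s, forall x, x != 0} -> is_lcm s l -> divides e l ->
  {in s, forall x, forall f, divides f e -> divides f x -> divides f z} ->
  divides e z.
Proof.
elim: s l e => [|x s IH] l e s0 sl el H.
  apply: divides_trans el _; apply: divides_trans _ (divides1 z).
  by apply: sl.2.
have s0' : {in s, forall y, y != 0} by move=> y ys; apply: s0; rewrite inE ys orbT.
have [l0 _ sl0] := lcm_exists hR s s0'.
have x0 : x != 0 by apply: s0; rewrite inE eqxx.
have {}sl := (is_lcm_cons _ _ _ _ sl0).1 sl.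
have [p [q [px ql /is_lcm2P[pe qe un]]]] := divides_lcm2_split hR _ _ _ _ x0 sl el.
apply: un; first by apply: (H x); rewrite ?inE ?eqxx.
apply: (IH l0) => // y ys f fq fy.
apply: (H y) => //; first by rewrite inE ys orbT.
exact: divides_trans qe.
Qed.

(** The factor [c] by which [y] grows when [x] is adjoined is the cofactor of
    the gcd of [x] and [y] in [x]; it is therefore the same for a divisor [y']
    of [y] having the same gcd with [x]. *)
Lemma lcm_cofactor_transfer {R : idomainType} (hR : gcd_domain R)
    (x y y' c : R) :
  x != 0 -> y != 0 -> is_lcm [:: x; y] (c * y) -> divides y' y ->
  (forall e, divides e x -> divides e y -> divides e y') ->
  is_lcm [:: x; y'] (c * y').
Proof.
move=> x0 y0 xyl y'y H.
have [g [x1 [y1 [g0 xE yE co]]]] := gcd_cofactors hR x y x0.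
have [y2 y'E] : divides g y' by apply: H; rewrite ?xE ?yE; apply: divides_mulr.
have co2 : coprime_elts x1 y2.
  apply: (coprime_elts_divides _ _ _ _ (divides_refl _) _ co).
  by apply: (divides_pmul2l g) => //; rewrite -yE mulrC -y'E.
have lcm1 := is_lcm_cofactors hR g x1 y1 g0 co.
rewrite -xE -yE in lcm1.
have xyE : x * y1 = y * x1 by rewrite xE yE mulrAC.
have cx : divides c x1.
  by apply: (divides_pmul2l y) => //; rewrite -xyE mulrC; apply: is_lcm_divides lcm1.
have xc : divides x1 c.
  apply: (divides_pmul2l y) => //; rewrite -xyE [y * c]mulrC.
  exact: is_lcm_divides xyl.
have := is_lcm_cofactors hR g x1 y2 g0 co2.
have -> : g * y2 = y' by rewrite y'E mulrC.
have -> : g * x1 * y2 = y' * x1 by rewrite y'E mulrAC [g * y2]mulrC.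
rewrite -xE => H2; apply: is_lcm_associated H2 _.
by apply/associatedP; rewrite [c * _]mulrC; split; apply: divides_mul2l.
Qed.

(** A common factor [e] of [x] and [y] can be cancelled once from the product
    [A * x * y] with the result still a common multiple of [A * x] and [A * y];
    minimality of the lcm makes [e] a unit. *)
Lemma coprime_elts_of_lcm {R : idomainType} (A x y : R) :
  A != 0 -> x != 0 -> y != 0 ->
  is_lcm [:: A * x; A * y] (A * (x * y)) -> coprime_elts x y.
Proof.
move=> A0 x0 y0 /is_lcm2P[_ _ un]; apply/coprime_eltsP => e [x1 xE] [y1 yE].
have /(divides_pmul2l _ _ _ A0) : divides (A * (x * y)) (A * (x * y1)).
  apply: un; apply: divides_mul2l; first exact: divides_mulr.
  by rewrite xE yE; exists x1; rewrite [y1 * e]mulrC mulrA.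
move=> /(divides_pmul2l _ _ _ x0); rewrite yE -{2}[y1]mulr1.
apply: divides_pmul2l; apply: contraNneq y0 => y10.
by rewrite yE y10 mul0r.
Qed.

(** * Lcm-sequences *)

Lemma iota1S (n : nat) : iota 1 n.+1 = rcons (iota 1 n) n.+1.
Proof. by rewrite -(addn1 n) iotaD cats1 add1n addn1. Qed.

Lemma prefix1S {R : idomainType} (a : nat -> R) (n : nat) :
  prefix1 a n.+1 = rcons (prefix1 a n) (a n.+1).
Proof. by rewrite /prefix1 iota1S map_rcons. Qed.

Lemma prod_iota1S {R : idomainType} (c : nat -> R) (n : nat) (P : pred nat) :
  \prod_(i <- iota 1 n.+1 | P i) c i =
  (\prod_(i <- iota 1 n | P i) c i) * (if P n.+1 then c n.+1 else 1).
Proof.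
by rewrite iota1S -cats1 big_cat /= big_cons big_nil mulr1.
Qed.

Lemma lcm_prefix1_prod {R : idomainType} (a c : nat -> R) :
  is_lcm_sequence a c ->
  forall n, is_lcm (prefix1 a n) (\prod_(i <- iota 1 n) c i).
Proof.
move=> [c1 cn]; elim=> [|[|n] IH].
- rewrite /= big_nil; split=> // e _; exact: divides1.
- rewrite /= big_seq1; apply: (@is_lcm_associated _ _ (a 1%N)).
    split=> [x|e]; first by rewrite inE => /eqP->; apply: divides_refl.
    by apply; rewrite inE.
  by move/associatedP: c1 => [? ?]; apply/associatedP.
have [//|l [l' [nl nl' /associatedP[cl lc]]]] := cn n.+2.
apply: is_lcm_associated nl _; rewrite prod_iota1S /= mulrC.
have l'P := is_lcm_divides _ _ _ nl' IH; have Pl' := is_lcm_divides _ _ _ IH nl'.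
apply/associatedP; split.
  exact: divides_trans lc (divides_mul2l _ _ _ _).
exact: divides_trans (divides_mul2l _ _ _ _) cl.
Qed.

Lemma lcm_seq_step {R : idomainType} (a c : nat -> R) (n : nat) :
  is_lcm_sequence a c ->
  is_lcm [:: a n.+1; \prod_(i <- iota 1 n) c i]
         (c n.+1 * \prod_(i <- iota 1 n) c i).
Proof.
move=> hc; apply/(is_lcm_cons _ _ _ _ (lcm_prefix1_prod _ _ hc n)).
have := lcm_prefix1_prod _ _ hc n.+1; rewrite prod_iota1S /= mulrC.
apply: is_lcm_eq_mem => x; by rewrite prefix1S mem_rcons.
Qed.

Lemma prefix1_neq0 {R : idomainType} (a : nat -> R) (n : nat) :
  (forall k, (1 <= k)%N -> a k != 0) -> {in prefix1 a n, forall x, x != 0}.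
Proof. by move=> ha x /mapP[i]; rewrite mem_iota => /andP[i1 _] ->; apply: ha. Qed.

Lemma lcm_seq_prod_neq0 {R : idomainType} (hR : gcd_domain R)
    (a c : nat -> R) (n : nat) :
  (forall k, (1 <= k)%N -> a k != 0) -> is_lcm_sequence a c ->
  \prod_(i <- iota 1 n) c i != 0.
Proof.
move=> ha hc; have [l l0 nl] := lcm_exists hR _ (prefix1_neq0 a n ha).
exact: divides_neq0 (is_lcm_divides _ _ _ (lcm_prefix1_prod _ _ hc n) nl) l0.
Qed.

Lemma lcm_seq_neq0 {R : idomainType} (hR : gcd_domain R) (a c : nat -> R) :
  (forall k, (1 <= k)%N -> a k != 0) -> is_lcm_sequence a c ->
  forall n, (1 <= n)%N -> c n != 0.
Proof.
move=> ha hc [//|n] _; have := lcm_seq_prod_neq0 hR a c n.+1 ha hc.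
by rewrite prod_iota1S /= mulf_eq0 negb_or => /andP[].
Qed.

Lemma perm_divisors_iota (n N : nat) :
  (1 <= n <= N)%N ->
  perm_eq (divisors n) [seq i <- iota 1 N | (i %| n)%N].
Proof.
move=> /andP[n1 nN]; apply: uniq_perm.
- exact: divisors_uniq.
- exact/filter_uniq/iota_uniq.
move=> i; rewrite -dvdn_divisors // mem_filter mem_iota add1n ltnS.
case: (boolP (i %| n)%N) => //= din.
by rewrite (dvdn_gt0 n1 din) (leq_trans (dvdn_leq n1 din)).
Qed.

Lemma prod_divisors_iota {R : idomainType} (c : nat -> R) (n N : nat) :
  (1 <= n <= N)%N ->
  \prod_(d <- divisors n) c d = \prod_(i <- iota 1 N | (i %| n)%N) c i.
Proof. by move=> nN; rewrite (perm_big _ (perm_divisors_iota _ _ nN)) /= big_filter. Qed.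

(** * From strong divisibility to the product formula *)

(** The divisor-closed set is given by [P], truncated at [N]; the induction
    adds its elements in increasing order, which keeps it divisor-closed. *)
Lemma lcm_dvd_closed_prod {R : idomainType} (hR : gcd_domain R)
    (a c : nat -> R) (P : pred nat) :
  (forall k, (1 <= k)%N -> a k != 0) -> is_lcm_sequence a c ->
  strong_divisibility_sequence a ->
  (forall i j, (i %| j)%N -> P j -> P i) ->
  forall N, is_lcm [seq a i | i <- iota 1 N & P i] (\prod_(i <- iota 1 N | P i) c i).
Proof.
move=> ha hc sd Pcl; elim=> [|n IH].
  by rewrite big_nil; split=> // e _; apply: divides1.
rewrite prod_iota1S iota1S filter_rcons.
case: ifP => Pn; last by rewrite mulr1.
rewrite map_rcons mulrC; apply: (@is_lcm_eq_mem _ (a n.+1 :: [seq a i | i <- iota 1 n & P i])).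
  by move=> x; rewrite mem_rcons.
apply/(is_lcm_cons _ _ _ _ IH).
apply: (lcm_cofactor_transfer hR _ _ _ _ _ _ (lcm_seq_step _ _ n hc) _ _).
- exact: ha.
- exact: (lcm_seq_prod_neq0 hR a c n ha hc).
- exact: divides_prod_filter.
move=> e ean eL.
apply: (divides_lcm_glue hR _ _ _ _ (prefix1_neq0 a n ha)
          (lcm_prefix1_prod _ _ hc n) eL).
move=> _ /mapP[k kn ->] f fe fak.
move: kn; rewrite mem_iota add1n ltnS => /andP[k1 kn].
have /is_gcd2P[_ _ /(_ f)] := sd n.+1 k isT k1.
move=> /(_ (divides_trans _ _ _ fe ean) fak) fg.
apply: divides_trans fg (IH.1 _ _); apply: map_f.
rewrite mem_filter (Pcl _ _ (dvdn_gcdl _ _) Pn) mem_iota gcdn_gt0 /= add1n ltnS.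
exact: leq_trans (dvdn_leq k1 (dvdn_gcdr _ _)) kn.
Qed.

Lemma prod_of_strong_divisibility {R : idomainType} (hR : gcd_domain R)
    (a c : nat -> R) (n : nat) :
  (forall k, (1 <= k)%N -> a k != 0) -> is_lcm_sequence a c ->
  strong_divisibility_sequence a -> (1 <= n)%N ->
  associated (a n) (\prod_(d <- divisors n) c d).
Proof.
move=> ha hc sd n1; rewrite (prod_divisors_iota _ _ n) ?n1 ?leqnn //.
have [dv un] := lcm_dvd_closed_prod hR a c (fun i => (i %| n)%N) ha hc sd
  (fun i j => @dvdn_trans j i n) n.
apply/associatedP; split.
  by apply: dv; apply: map_f; rewrite mem_filter dvdnn mem_iota n1 add1n ltnS leqnn.
apply: un => x /mapP[i]; rewrite mem_filter mem_iota => /and3P[din i1 _] ->.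
by have /is_gcd2P[] := sd i n i1 n1; rewrite (gcdn_idPl din).
Qed.

(** * From the product formula to strong divisibility *)

(** The product formula splits the lcm [L_(j-1)] into [A], the cofactor of [c_j]
    in [a_j], and [B], which has [c_i] as a factor.  Since adjoining [a_j]
    multiplies [A * B] by the whole of [c_j], the elements [c_j] and [B] are
    coprime. *)
Lemma coprime_lcm_seq_lt {R : idomainType} (hR : gcd_domain R)
    (a c : nat -> R) (i j : nat) :
  (forall k, (1 <= k)%N -> a k != 0) -> is_lcm_sequence a c ->
  (forall n, (1 <= n)%N -> associated (a n) (\prod_(d <- divisors n) c d)) ->
  (1 <= i < j)%N -> ~~ (i %| j)%N -> coprime_elts (c j) (c i).
Proof.
move=> ha hc H; case: j => [|n]; first by rewrite ltn0 andbF.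
rewrite ltnS => /andP[i1 ij] nd.
have := lcm_seq_step _ _ n hc; have := lcm_seq_prod_neq0 hR a c n ha hc.
rewrite (bigID (fun k => (k %| n.+1)%N)) /=.
set A := \prod_(k <- _ | _) _; set B := \prod_(k <- _ | _) _.
rewrite mulf_eq0 negb_or => /andP[A0 B0] /is_lcm2P[xl yl un].
(* The hypothesis gives [a_j] as [A * c_j] up to a unit, so the lcm at hand is
   also that of [A * c_j] and [A * B]. *)
have /associatedP[aP Pa] := H n.+1 isT.
move: aP Pa; rewrite (prod_divisors_iota _ _ n.+1) ?leqnn //.
rewrite prod_iota1S dvdnn -/A => aP Pa.
have co : coprime_elts (c n.+1) B.
  apply: (coprime_elts_of_lcm A) => //.
    exact: (lcm_seq_neq0 hR a c).
  rewrite mulrCA; apply/is_lcm2P; split=> // [|e Ae]; first exact: divides_trans xl.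
  apply: un; exact: divides_trans Ae.
apply: (coprime_elts_divides _ _ _ _ (divides_refl _) _ co); rewrite /B -big_filter.
have im : i \in [seq k <- iota 1 n | ~~ (k %| n.+1)%N].
  by rewrite mem_filter nd mem_iota i1 add1n ltnS.
by rewrite (big_rem _ im) /=; apply: divides_mulr.
Qed.

Lemma coprime_lcm_seq {R : idomainType} (hR : gcd_domain R)
    (a c : nat -> R) (i j : nat) :
  (forall k, (1 <= k)%N -> a k != 0) -> is_lcm_sequence a c ->
  (forall n, (1 <= n)%N -> associated (a n) (\prod_(d <- divisors n) c d)) ->
  (1 <= i)%N -> (1 <= j)%N -> ~~ (i %| j)%N -> ~~ (j %| i)%N ->
  coprime_elts (c i) (c j).
Proof.
move=> ha hc H i1 j1 nij nji; have [ij|ij|ij] := ltngtP i j.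
- by apply/coprime_elts_sym/(coprime_lcm_seq_lt hR a); rewrite ?i1.
- by apply: (coprime_lcm_seq_lt hR a); rewrite ?j1.
- by rewrite ij dvdnn in nij.
Qed.

Lemma prod_divisors_gcdl {R : idomainType} (c : nat -> R) (m n N : nat) :
  (1 <= m <= N)%N ->
  \prod_(d <- divisors m) c d =
  \prod_(d <- divisors (gcdn m n)) c d *
  \prod_(i <- iota 1 N | (i %| m)%N && ~~ (i %| n)%N) c i.
Proof.
move=> /andP[m1 mN].
rewrite (prod_divisors_iota _ m N) ?m1 // (prod_divisors_iota _ (gcdn m n) N).
  rewrite (bigID (fun i => (i %| n)%N)) /=; congr (_ * _).
  by apply: eq_bigl => i; rewrite dvdn_gcd.
by rewrite gcdn_gt0 m1 (leq_trans (dvdn_leq m1 (dvdn_gcdl m n))).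
Qed.

Lemma strong_divisibility_of_prod {R : idomainType} (hR : gcd_domain R)
    (a c : nat -> R) :
  (forall k, (1 <= k)%N -> a k != 0) -> is_lcm_sequence a c ->
  (forall n, (1 <= n)%N -> associated (a n) (\prod_(d <- divisors n) c d)) ->
  strong_divisibility_sequence a.
Proof.
move=> ha hc H m n m1 n1; pose N := maxn m n.
have /associatedP[am ma] := H m m1; have /associatedP[an na] := H n n1.
have g1 : (1 <= gcdn m n)%N by rewrite gcdn_gt0 m1.
have /associatedP[ag ga] := H _ g1.
move: am ma; rewrite (prod_divisors_gcdl c m n N) ?m1 ?leq_maxl // => am ma.
move: an na; rewrite (prod_divisors_gcdl c n m N) ?n1 ?leq_maxr // gcdnC => an na.
set g := \prod_(d <- divisors _) c d in ag ga am ma an na.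
set P := \prod_(i <- _ | _) _ in am ma; set Q := \prod_(i <- _ | _) _ in an na.
have co : coprime_elts P Q.
  apply: (coprime_elts_prod hR) => j /=; rewrite mem_iota.
  move=> /andP[j1 _] /andP[jn njm]; apply: coprime_elts_sym.
  apply: (coprime_elts_prod hR) => i /=; rewrite mem_iota.
  move=> /andP[i1 _] /andP[im nin].
  apply: (coprime_lcm_seq hR a) => //.
    by apply: contra njm => /dvdn_trans; apply.
  by apply: contra nin => /dvdn_trans; apply.
have /is_gcd2P[gP gQ un] := is_gcd_mull hR g _ _ _ co; rewrite mulr1 in gP gQ un.
apply/is_gcd2P; split=> [||e em en].
- exact: divides_trans ag (divides_trans _ _ _ gP ma).
- exact: divides_trans ag (divides_trans _ _ _ gQ na).
apply: divides_trans ga; apply: un; [exact: divides_trans am | exact: divides_trans an].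
Qed.

Theorem theorem2p1 (R : idomainType) (hR : gcd_domain R) (a c : nat -> R)
    (ha : forall n : nat, (1 <= n)%N -> a n != 0)
    (hc : is_lcm_sequence a c) :
  strong_divisibility_sequence a <->
  (forall n : nat, (1 <= n)%N ->
     associated (a n) (\prod_(d <- divisors n) c d)).
Proof.
split=> [sd n n1|H]; first exact: prod_of_strong_divisibility.
exact: (strong_divisibility_of_prod hR a c ha hc H).
Qed.
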